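(* Let $M=M[\mathcal{I}]$ be a multi-path matroid on $S$ of rank $r$ and nullity $m$, presented by an antichain $\mathcal{I}$ of $\sigma$-intervals, and fix $x\in S$. A set $B\subseteq S$ is a basis of $M$ if and only if there is a lattice path $R$ such that (i) $R$ goes from some point $p_i$ to the corresponding point $p'_i$ ($1\le i\le k$), (ii) $R$ uses East and North steps of the diagram $D(\mathcal{I},x)$ (i.e. $R$ stays in its region), and (iii) the labels on the North steps of $R$ are exactly the elements of $B$.
   Context: Transversal matroid $M[\mathcal{A}]$ of a multiset $\mathcal{A}$ of subsets of a finite set $S$: its independent sets are the partial transversals (sets of distinct elements chosen from distinct members, one from each chosen member). For a cyclic permutation $\sigma$ of $S$, a $\sigma$-interval is a nonempty set $I=\{f_I,\sigma(f_I),\ldots,l_I\}$ with first element $f_I$ and last element $l_I$. $\mathcal{I}$ is an antichain (no member contains another) of $r$ $\sigma$-intervals; $|S|=m+r$. The diagram $D(\mathcal{I},x)$: let $k-1$ be the number of intervals $I\in\mathcal{I}$ with $x\in I$ and $x\ne f_I$. For $1\le i\le k$ let $p_i=(k-i,i-1)$ and $p'_i=p_i+(m,r)$; let $L$, $L'$ be the lines of slope $-1$ through the $p_i$, resp. the $p'_i$. Let $P$ be the lattice path from $p_1$ to $p'_1$ whose $t$-th step ($1\le t\le m+r$) is North $(0,1)$ if $\sigma^{t-1}(x)$ is the last element of some interval of $\mathcal{I}$ and East $(1,0)$ otherwise; let $Q$ be the lattice path from $p_k$ to $p'_k$ whose $t$-th step is North if $\sigma^{t-1}(x)$ is the first element of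 some interval of $\mathcal{I}$ and East otherwise ($P$ never goes above $Q$). The region of the diagram is the closed region bounded by $L$, $L'$, $P$, $Q$; its steps (edges) are the unit segments between lattice points lying in it. A step starting at the lattice point $(a,b)$ with $a+b=k-1+(t-1)$ (i.e. the $t$-th step of any lattice path starting on $L$) is labelled $\sigma^{t-1}(x)$. *)

(* Defs.v *)
From mathcomp Require Import all_boot all_fingroup.

Set Implicit Arguments.
Unset Strict Implicit.
Unset Printing Implicit Defensive.

(* The assignment [phi] of members of the family to the elements of [X] is
   option-valued so that [set0] is independent even when the family is empty. *)
Definition partial_transversal (S J : finType) (A : J -> {set S})
    (X : {set S}) : bool :=
  [exists phi : {ffun S -> option J},
     [forall y in X, exists j, (phi y == Some j) && (y \in A j)] &&
     [forall y in X, forall z in X, (phi y == phi z) ==> (y == z)]].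

Definition transversal_basis (S J : finType) (A : J -> {set S})
    (B : {set S}) : bool :=
  maxset (partial_transversal A) B.

Definition antichain (S J : finType) (A : J -> {set S}) : Prop :=
  forall i j : J, i != j -> ~~ (A i \subset A j).

Definition cyclic_perm (S : finType) (s : {perm S}) : Prop :=
  forall a b : S, b \in porbit s a.

(* The interval {a, s a, ..., b}: [findex s a b] is the least [d] with
   [s^d a = b], which exists when [s] is cyclic.  The whole set S is obtained
   for every [a], with [b = s^-1 a]; the end points are therefore kept as data
   instead of being read off the underlying set. *)
Definition sinterval (S : finType) (s : {perm S}) (a b : S) : {set S} :=
  [set y in traject s a (findex s a b).+1].

(* In the rest of the file, a family of r intervals is given by its first and
   last elements [f l : 'I_r -> S]. *)
Definition intervals (S : finType) (s : {perm S}) (r : nat)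
    (f l : 'I_r -> S) : 'I_r -> {set S} :=
  fun j => sinterval s (f j) (l j).

Variant step := East | North.

Definition is_north (d : step) : bool := if d is North then true else false.

Definition point := (nat * nat)%type.

Definition move (p : point) (d : step) : point :=
  match d with East => (p.1.+1, p.2) | North => (p.1, p.2.+1) end.

(* A lattice path is a starting point together with its sequence of steps. *)
Definition path_end (p : point) (w : seq step) : point := foldl move p w.

Fixpoint path_steps (p : point) (w : seq step) : seq (point * step) :=
  if w is d :: w' then (p, d) :: path_steps (move p d) w' else [::].

Definition diag_k (S : finType) (s : {perm S}) (r : nat) (f l : 'I_r -> S)
    (x : S) : nat :=
  #|[set j | (x \in intervals s f l j) && (x != f j)]|.+1.

(* Meant for 1 <= i <= k, where the truncated subtractions are exact. *)
Definition diag_start (k i : nat) : point := (k - i, i - 1).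

Definition diag_end (k m r i : nat) : point :=
  ((diag_start k i).1 + m, (diag_start k i).2 + r).

(* With [g := l] these are the steps of P, with [g := f] those of Q. *)
Definition bound_steps (S : finType) (s : {perm S}) (m r : nat)
    (g : 'I_r -> S) (x : S) : seq step :=
  mkseq (fun t => if [exists j, g j == iter t s x] then North else East)
        (m + r).

(* The lattice points between L and L', on or above P and on or below Q; the
   comparison is made along the line of slope -1 through the point, which P and
   Q both meet after [t] steps. *)
Definition in_region (S : finType) (s : {perm S}) (m r : nat)
    (f l : 'I_r -> S) (x : S) (p : point) : bool :=
  let k := diag_k s f l x in
  let t := p.1 + p.2 - (k - 1) in
  [&& k - 1 <= p.1 + p.2, p.1 + p.2 <= k - 1 + (m + r),
      (path_end (diag_start k 1) (take t (bound_steps s m l x))).2 <= p.2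
    & p.2 <= (path_end (diag_start k k) (take t (bound_steps s m f x))).2].

Definition diag_step (S : finType) (s : {perm S}) (m r : nat)
    (f l : 'I_r -> S) (x : S) (e : point * step) : bool :=
  in_region s m f l x e.1 && in_region s m f l x (move e.1 e.2).

Definition step_label (S : finType) (s : {perm S}) (k : nat) (x : S)
    (e : point * step) : S :=
  iter (e.1.1 + e.1.2 - (k - 1)) s x.

Definition north_labels (S : finType) (s : {perm S}) (k : nat) (x : S)
    (p : point) (w : seq step) : {set S} :=
  [set y in [seq step_label s k x e | e <- path_steps p w & is_north e.2]].

(* Main.v *)
Require Import Defs.
From mathcomp Require Import all_boot all_fingroup zify.

Set Implicit Arguments.
Unset Strict Implicit.
Unset Printing Implicit Defensive.

(* Number the elements of [S] by their position after [x] along [s].  If [g j]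
   is the element of the basis [B] matched with the [j]-th interval, comparing
   the positions of [f j], [g j] and [l j] one [j] at a time shows that
   (#l below u) - (#B below u) <= (k - 1) + (#f below t) - (#B below t) for all
   [t] and [u].  The largest left-hand side is then the starting height of a path
   with North steps [B] that lies between P and Q.  Conversely, the antichain
   condition makes the cyclic orders of the first and of the last elements agree,
   up to a shift by [k - 1], so a path of the diagram starting at height [h]
   matches its [q]-th North step (from 0) with the interval whose last element
   has rank [h + q] mod [r]. *)

(** * Matchings and bases of transversal matroids *)

(** The condition on [phi] in [partial_transversal], named so that a matching can be selected by an
    extremal choice. *)
Definition matching (S J : finType) (A : J -> {set S}) (X : {set S})
    (phi : {ffun S -> option J}) : bool :=
  [forall y in X, exists j, (phi y == Some j) && (y \in A j)] &&
  [forall y in X, forall z in X, (phi y == phi z) ==> (y == z)].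

Lemma matchingP (S J : finType) (A : J -> {set S}) (X : {set S})
    (phi : {ffun S -> option J}) :
  reflect ({in X, forall y, exists2 j, phi y = Some j & y \in A j} /\
           {in X &, injective phi})
          (matching A X phi).
Proof.
apply: (iffP andP) => -[].
  move=> /forall_inP h1 /forall_inP h2; split.
    by move=> y /h1 /existsP[j /andP[/eqP]]; exists j.
  by move=> y z yX zX e; move/forall_inP: (h2 y yX) => /(_ z zX);
    rewrite e eqxx => /eqP.
move=> h1 h2; split.
  apply/forall_inP=> y /h1[j e yj]; apply/existsP; exists j.
  by rewrite e eqxx.
apply/forall_inP=> y yX; apply/forall_inP=> z zX; apply/implyP=> /eqP e.
by apply/eqP/h2.
Qed.

Lemma partial_transversalP (S J : finType) (A : J -> {set S}) (X : {set S}) :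
  reflect (exists phi, matching A X phi) (partial_transversal A X).
Proof. exact: existsP. Qed.

Lemma card_partial_transversal (S J : finType) (A : J -> {set S})
    (X : {set S}) : partial_transversal A X -> #|X| <= #|J|.
Proof.
case/partial_transversalP=> phi /matchingP[h1 h2].
rewrite -(card_in_imset h2) -cardsT -(card_imset [set: J] Some_inj).
by apply/subset_leq_card/subsetP=> _ /imsetP[y /h1[j -> _] ->]; rewrite imset_f.
Qed.

(* Among the matchings of [X], take one that agrees with the system of distinct
   representatives [f] as often as possible: rerouting [f j], for an unmatched
   [j], would increase the agreement, so that [f j] is not in [X]. *)
Lemma partial_transversal_extend (S J : finType) (A : J -> {set S})
    (f : J -> S) (X : {set S}) :
    injective f -> (forall j, f j \in A j) ->
    partial_transversal A X -> #|X| < #|J| ->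
  exists2 y, y \notin X & partial_transversal A (y |: X).
Proof.
move=> finj fA ptX ltX.
have [phi0 ok0] := partial_transversalP _ _ ptX.
pose agree (phi : {ffun S -> option J}) :=
  [set j | (f j \in X) && (phi (f j) == Some j)].
case: (@arg_maxnP _ phi0 (matching A X) (fun phi => #|agree phi|) ok0) => phi okphi phimax.
have [h1 h2] := matchingP _ _ _ okphi.
have [j jfree] : exists j, Some j \notin phi @: X.
  apply/existsP; rewrite -negb_forall; apply/negP=> /forallP jused.
  suff : #|J| <= #|X| by rewrite leqNgt ltX.
  rewrite -(card_in_imset h2) -cardsT -(card_imset [set: J] Some_inj).
  by apply/subset_leq_card/subsetP=> _ /imsetP[j _ ->]; apply: jused.
have notj y : y \in X -> phi y <> Some j.
  by move=> yX e; move/negP: jfree; apply; rewrite -e imset_f.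
pose psi := [ffun y => if y == f j then Some j else phi y].
have psi1 y : y \in f j |: X -> exists2 i, psi y = Some i & y \in A i.
  rewrite !inE ffunE; case: eqP => [-> _|_ /= /h1//]; by exists j.
have psi2 : {in f j |: X &, injective psi}.
  move=> y z; rewrite !inE !ffunE.
  case: eqP => [->|_]; case: eqP => [->|_] //= yX zX e.
  - by case: (notj z zX).
  - by case: (notj y yX).
  - exact: h2.
exists (f j); last by apply/partial_transversalP; exists psi; apply/matchingP.
apply/negP=> fjX; have fjXE : f j |: X = X by apply/setUidPr; rewrite sub1set.
rewrite fjXE in psi1 psi2.
have /phimax : matching A X psi by apply/matchingP.
apply/negP; rewrite -ltnNge; apply/proper_card/properP; split.
  apply/subsetP=> i; rewrite !inE ffunE => /andP[-> /= ei].
  by case: (f i =P f j) => // /finj ->.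
by exists j; rewrite !inE ?ffunE fjX ?eqxx //=; apply/eqP/notj.
Qed.

(** A maximal partial transversal with fewer than |J| elements could be enlarged, because the
    distinct representatives [f] exist; |J| is an upper bound in any case. *)
Lemma transversal_basisE (S J : finType) (A : J -> {set S})
    (f : J -> S) (B : {set S}) :
    injective f -> (forall j, f j \in A j) ->
  transversal_basis A B = partial_transversal A B && (#|B| == #|J|).
Proof.
move=> finj fA; apply/maxsetP/andP => [[ptB maxB]|[ptB /eqP cB]].
  split=> //; rewrite eqn_leq (card_partial_transversal ptB) /= leqNgt.
  apply/negP=> /(partial_transversal_extend finj fA ptB)[y yB /maxB].
  by move=> e; move: yB; rewrite -e ?setU11 ?subsetUr.
split=> // C ptC sBC; apply/esym/eqP; rewrite eqEcard sBC cB.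
exact: card_partial_transversal ptC.
Qed.

(** A matching of a basis is injective into a family of the same size, hence meets every member and
    can be inverted to [g]. *)
Lemma transversal_basis_matching (S J : finType) (A : J -> {set S})
    (f : J -> S) (B : {set S}) :
    injective f -> (forall j, f j \in A j) -> transversal_basis A B ->
  exists g : J -> S,
    [/\ injective g, forall j, g j \in A j & B = g @: [set: J]].
Proof.
move=> finj fA; rewrite (transversal_basisE _ finj fA) => /andP[ptB /eqP cB].
case/partial_transversalP: ptB => phi /matchingP[h1 h2].
have imB : phi @: B = Some @: [set: J].
  apply/eqP; rewrite eqEcard (card_in_imset h2) card_imset ?cardsT ?cB ?leqnn //;
    last exact: Some_inj.
  by rewrite andbT; apply/subsetP=> _ /imsetP[y /h1[j -> _] ->]; rewrite imset_f.
have /fin_all_exists2[g gB gE] j : exists2 y, y \in B & phi y = Some j.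
  have : Some j \in phi @: B by rewrite imB imset_f.
  by case/imsetP=> y yB e; exists y.
have ginj : injective g by move=> i j e; apply: Some_inj; rewrite -!gE e.
exists g; split=> // [j|].
  by have [i e] := h1 _ (gB j); move: e; rewrite gE => -[<-].
apply/esym/eqP; rewrite eqEcard card_imset // cardsT cB leqnn andbT.
by apply/subsetP=> _ /imsetP[j _ ->].
Qed.

(** * Positions along a cyclic permutation *)

(** For a cyclic [s], cutting the cycle open just before [x] gives a linear order, in which [y] has
    this position, counted from 0. *)
Definition cpos (S : finType) (s : {perm S}) (x y : S) : nat := findex s x y.

Lemma cyclic_fconnect (S : finType) (s : {perm S}) (a b : S) :
  cyclic_perm s -> fconnect s a b.
Proof.
move=> cyc; have /porbitP[i ->] := cyc a b.
by rewrite permX fconnect_iter.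
Qed.

Lemma cyclic_order (S : finType) (s : {perm S}) (a : S) :
  cyclic_perm s -> fingraph.order s a = #|S|.
Proof.
by move=> cyc; apply: eq_card => b; rewrite !inE cyclic_fconnect.
Qed.

Lemma iter_cpos (S : finType) (s : {perm S}) (x y : S) :
  cyclic_perm s -> iter (cpos s x y) s x = y.
Proof. by move=> cyc; apply/iter_findex/cyclic_fconnect. Qed.

Lemma cpos_lt (S : finType) (s : {perm S}) (x y : S) :
  cyclic_perm s -> cpos s x y < #|S|.
Proof.
by move=> cyc; rewrite -(cyclic_order x cyc) findex_max // cyclic_fconnect.
Qed.

Lemma cpos_iter (S : finType) (s : {perm S}) (x : S) (t : nat) :
  cyclic_perm s -> t < #|S| -> cpos s x (iter t s x) = t.
Proof. by move=> cyc tS; rewrite /cpos findex_iter // cyclic_order. Qed.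

Lemma cpos_inj (S : finType) (s : {perm S}) (x : S) :
  cyclic_perm s -> injective (cpos s x).
Proof.
by move=> cyc y z e; rewrite -(iter_cpos x y cyc) e iter_cpos.
Qed.

(** Changing the origin shifts positions modulo |S|. Intervals, which are counted from their own
    first elements, can then all be compared from the single origin [x]. *)
Lemma cpos_change (S : finType) (s : {perm S}) (x a y : S) :
  cyclic_perm s ->
  cpos s a y = if cpos s x a <= cpos s x y then cpos s x y - cpos s x a
               else cpos s x y + #|S| - cpos s x a.
Proof.
move=> cyc; have := cpos_lt x a cyc; have := cpos_lt x y cyc.
have shiftE d : cpos s x a <= d -> iter (d - cpos s x a) s a = iter d s x.
  by move=> le_ad; rewrite -{2}(subnK le_ad) iterD iter_cpos.
move=> ltyN ltaN; case: leqP => [le_ay|lt_ya].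
  rewrite -[in LHS](iter_cpos x y cyc) -shiftE // cpos_iter //; lia.
have e : y = iter (cpos s x y + #|S| - cpos s x a) s a.
  rewrite shiftE; last by lia.
  rewrite iterD -(cyclic_order x cyc) iter_order ?iter_cpos //.
  exact: perm_inj.
by rewrite [in LHS]e cpos_iter //; lia.
Qed.

(** The second alternative is an interval that runs across the cut before [x]: a final segment of
    positions together with an initial one. *)
Lemma mem_sinterval (S : finType) (s : {perm S}) (x a b y : S) :
  cyclic_perm s ->
  (y \in sinterval s a b) =
    (cpos s x a <= cpos s x y <= cpos s x b) ||
    (cpos s x b < cpos s x a) &&
      ((cpos s x a <= cpos s x y) || (cpos s x y <= cpos s x b)).
Proof.
move=> cyc.
have -> : (y \in sinterval s a b) = (cpos s a y <= cpos s a b).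
  rewrite inE; apply/trajectP/idP => [[i lt_ib ->]|le_yb].
    by rewrite cpos_iter //; apply: leq_trans lt_ib _; apply: cpos_lt.
  by exists (cpos s a y); rewrite ?iter_cpos.
rewrite !(cpos_change x a _ cyc).
have ltyN := cpos_lt x y cyc; have ltbN := cpos_lt x b cyc.
have ltaN := cpos_lt x a cyc.
case: (leqP (cpos s x a) (cpos s x y)); case: (leqP (cpos s x a) (cpos s x b));
  by lia.
Qed.

Lemma first_mem_intervals (S : finType) (s : {perm S}) (r : nat)
    (f l : 'I_r -> S) (j : 'I_r) : f j \in intervals s f l j.
Proof. by rewrite inE trajectS mem_head. Qed.

(** If both intervals cross the cut before [x], or neither does, nested end points give containment.
    An interval that does not cross lies inside one that does as soon as it starts late enough or
    ends early enough. The antichain condition excludes both situations. *)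
Lemma antichain_cpos (S : finType) (s : {perm S}) (r : nat)
    (f l : 'I_r -> S) (x : S) (i j : 'I_r) :
    cyclic_perm s -> antichain (intervals s f l) -> i != j ->
  let a := cpos s x \o f in let b := cpos s x \o l in
  ((b i < a i) = (b j < a j) -> ~ (a j <= a i /\ b i <= b j)) /\
  (a i <= b i -> b j < a j -> a i < a j /\ b j < b i).
Proof.
move=> cyc anti neq_ij a b.
have nsub : ~ forall y, y \in intervals s f l i -> y \in intervals s f l j.
  by move=> sub; have /negP := anti _ _ neq_ij; apply; apply/subsetP.
split=> [ew [le_a le_b]|nwi wj].
  apply: nsub => y; rewrite !(mem_sinterval x _ _ _ cyc).
  rewrite /a /b /= in ew le_a le_b; lia.
rewrite !ltnNge; apply/andP; rewrite -negb_or; apply/negP=> h.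
apply: nsub => y; rewrite !(mem_sinterval x _ _ _ cyc).
rewrite /a /b /= in nwi wj h; lia.
Qed.

(** * Counting along the cyclic order *)

(** The height gained in t steps by a path with North labels [X]; at the position of an element of
    [X] it is the rank of that element, counted from 0. *)
Definition below (S : finType) (s : {perm S}) (x : S) (X : {set S}) (t : nat)
    : nat := #|[set y in X | cpos s x y < t]|.

Lemma below0 (S : finType) (s : {perm S}) (x : S) (X : {set S}) :
  below s x X 0 = 0.
Proof. by apply: eq_card0 => y; rewrite !inE ltn0 andbF. Qed.

Lemma belowS (S : finType) (s : {perm S}) (x : S) (X : {set S}) (t : nat) :
    cyclic_perm s -> t < #|S| ->
  below s x X t.+1 = below s x X t + (iter t s x \in X).
Proof.
move=> cyc tS; have posE y : (cpos s x y == t) = (y == iter t s x).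
  by rewrite -(inj_eq (@cpos_inj _ s x cyc)) cpos_iter.
rewrite /below; set y0 := iter t s x.
have [y0X|y0X] := boolP (y0 \in X).
  have := cardsU1 y0 [set y in X | cpos s x y < t].
  rewrite inE cpos_iter // ltnn andbF /= add1n addn1 => <-.
  apply: eq_card => y; rewrite !inE ltnS leq_eqVlt posE.
  by case: eqP => [->|]; rewrite ?y0X.
rewrite addn0; apply: eq_card => y; rewrite !inE ltnS leq_eqVlt posE.
by case: eqP => [->|]; rewrite ?(negPf y0X).
Qed.

Lemma below_card (S : finType) (s : {perm S}) (x : S) (X : {set S}) :
  cyclic_perm s -> below s x X #|S| = #|X|.
Proof. by move=> cyc; apply: eq_card => y; rewrite !inE cpos_lt ?andbT. Qed.

Lemma below_le_card (S : finType) (s : {perm S}) (x : S) (X : {set S})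
    (t : nat) : below s x X t <= #|X|.
Proof. by apply/subset_leq_card/subsetP=> y; rewrite inE => /andP[]. Qed.

Lemma below_le (S : finType) (s : {perm S}) (x : S) (X : {set S})
    (t u : nat) : t <= u -> below s x X t <= below s x X u.
Proof.
move=> tu; apply/subset_leq_card/subsetP=> y; rewrite !inE => /andP[->] /=.
by move/leq_trans; apply.
Qed.

Lemma below_lt (S : finType) (s : {perm S}) (x : S) (X : {set S})
    (y : S) (t u : nat) :
    y \in X -> t <= cpos s x y < u -> below s x X t < below s x X u.
Proof.
move=> yX /andP[ty yu]; apply/proper_card/properP; split.
  apply/subsetP=> z; rewrite !inE => /andP[-> /leq_trans] /=; apply.
  by apply: ltnW; apply: leq_ltn_trans yu.
by exists y; rewrite !inE yX //= -leqNgt.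
Qed.

Lemma below_rank_lt (S : finType) (s : {perm S}) (x : S) (X : {set S}) (y : S) :
  cyclic_perm s -> y \in X -> below s x X (cpos s x y) < #|X|.
Proof.
move=> cyc yX; rewrite -(below_card x X cyc); apply: below_lt yX _.
by rewrite leqnn cpos_lt.
Qed.

Lemma below_rank_inj (S : finType) (s : {perm S}) (x : S) (X : {set S}) :
  cyclic_perm s -> {in X &, injective (fun y => below s x X (cpos s x y))}.
Proof.
move=> cyc y z yX zX e; apply: (@cpos_inj _ s x cyc).
case: (ltngtP (cpos s x y) (cpos s x z)) => // lt.
  have : below s x X (cpos s x y) < below s x X (cpos s x z).
    by apply: below_lt yX _; rewrite leqnn.
  by rewrite e ltnn.
have : below s x X (cpos s x z) < below s x X (cpos s x y).
  by apply: below_lt zX _; rewrite leqnn.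
by rewrite e ltnn.
Qed.

(** As sums over the family, counts can be compared one interval at a time. *)
Lemma below_imset (S : finType) (s : {perm S}) (x : S) (r : nat)
    (g : 'I_r -> S) (t : nat) : injective g ->
  below s x (g @: [set: 'I_r]) t = \sum_j (cpos s x (g j) < t).
Proof.
move=> ginj; rewrite -big_mkcond sum1dep_card /below -(card_imset _ ginj).
apply: eq_card => y; rewrite !inE; apply/andP/imsetP.
  by case=> /imsetP[j _ ->] h; exists j; rewrite ?inE.
by case=> j; rewrite inE => h ->; rewrite imset_f.
Qed.

(** * Lattice paths *)

Definition indicator_word (S : finType) (s : {perm S}) (x : S) (X : {set S})
    : seq step :=
  mkseq (fun t => if iter t s x \in X then North else East) #|S|.

Lemma count_indicator_word (S : finType) (s : {perm S}) (x : S) (X : {set S})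
    (t : nat) :
    cyclic_perm s -> t <= #|S| ->
  count is_north (take t (indicator_word s x X)) = below s x X t.
Proof.
move=> cyc; elim: t => [|t IHt] tS; first by rewrite take0 below0.
rewrite (take_nth East) ?size_mkseq // -cats1 count_cat /= addn0.
rewrite belowS // IHt 1?ltnW // nth_mkseq //.
by case: (_ \in X).
Qed.

Lemma path_endE (p : point) (w : seq step) :
  path_end p w = (p.1 + (size w - count is_north w), p.2 + count is_north w).
Proof.
elim: w p => [|d w IHw] p /=; first by rewrite !addn0 -surjective_pairing.
have := count_size is_north w.
rewrite -[LHS]/(path_end (move p d) w) IHw.
by case: d => /= h; congr pair; lia.
Qed.

Lemma path_stepsE (p : point) (w : seq step) :
  path_steps p w =
  mkseq (fun t => (path_end p (take t w), nth East w t)) (size w).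
Proof.
elim: w p => [|d w IHw] p //=.
by rewrite IHw /mkseq /= -[1]addn0 iotaDl -map_comp.
Qed.

(** After t steps from any starting point on L the coordinates sum to k - 1 + t, so the label of a
    step depends on its index alone. *)
Lemma north_labelsE (S : finType) (s : {perm S}) (k i : nat) (x : S)
    (w : seq step) :
    cyclic_perm s -> 1 <= i <= k -> size w = #|S| ->
  north_labels s k x (diag_start k i) w =
  [set y | is_north (nth East w (cpos s x y))].
Proof.
move=> cyc ik sw; apply/setP=> y; rewrite !inE path_stepsE.
have labelE t : t < #|S| ->
    step_label s k x (path_end (diag_start k i) (take t w), nth East w t)
      = iter t s x.
  move=> tS; rewrite /step_label path_endE /= size_take_min sw.
  congr (iter _ s x); have := count_size is_north (take t w).
  by rewrite size_take_min sw; lia.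
rewrite filter_map -map_comp; apply/mapP/idP.
  case=> t; rewrite mem_filter mem_iota add0n sw /= => /andP[tn tS] ->.
  by rewrite labelE // cpos_iter.
move=> yn; exists (cpos s x y); last by rewrite /= labelE ?iter_cpos ?cpos_lt.
by rewrite mem_filter mem_iota add0n sw cpos_lt //= yn.
Qed.

(** The word of a path is recovered from its North labels, so only the starting point remains to be
    chosen. *)
Lemma north_labels_word (S : finType) (s : {perm S}) (k i : nat) (x : S)
    (w : seq step) (B : {set S}) :
    cyclic_perm s -> 1 <= i <= k -> size w = #|S| ->
  north_labels s k x (diag_start k i) w = B <-> w = indicator_word s x B.
Proof.
move=> cyc ik sw; rewrite north_labelsE //; split=> [<-|->].
  apply: (@eq_from_nth _ East) => [|t]; rewrite ?size_mkseq // sw => tS.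
  by rewrite nth_mkseq // inE cpos_iter //; case: (nth _ w t).
apply/setP=> y; rewrite inE nth_mkseq ?cpos_lt // iter_cpos //.
by case: (y \in B).
Qed.

Lemma bound_steps_word (S : finType) (s : {perm S}) (m r : nat)
    (g : 'I_r -> S) (x : S) :
  #|S| = m + r ->
  bound_steps s m g x = indicator_word s x (g @: [set: 'I_r]).
Proof.
move=> cS; rewrite /bound_steps /indicator_word cS; apply: eq_mkseq => t.
congr (if _ then _ else _); apply/existsP/imsetP => [[j /eqP <-]|[j _ ->]];
  by exists j.
Qed.

(** After t steps the path, P and Q lie on one line of slope -1, so only heights are compared; the
    starting heights are i - 1, 0 and k - 1. *)
Lemma in_region_path_end (S : finType) (s : {perm S}) (m r : nat)
    (f l : 'I_r -> S) (x : S) (B : {set S}) (i t : nat) :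
    cyclic_perm s -> #|S| = m + r ->
    let k := diag_k s f l x in 1 <= i <= k -> t <= #|S| ->
  in_region s m f l x
    (path_end (diag_start k i) (take t (indicator_word s x B))) =
  (below s x (l @: [set: 'I_r]) t <= i - 1 + below s x B t
     <= k - 1 + below s x (f @: [set: 'I_r]) t).
Proof.
move=> cyc cS k ik tS; rewrite /in_region -/k !bound_steps_word //.
rewrite [path_end (diag_start k i) _]path_endE (count_indicator_word _ _ cyc tS).
rewrite size_take_min size_mkseq /=.
have le_Bt : below s x B t <= t.
  rewrite -count_indicator_word // (leq_trans (count_size _ _)) //.
  by rewrite size_take_min geq_minl.
have -> : k - i + (minn t #|S| - below s x B t) + (i - 1 + below s x B t)
   = k - 1 + t by lia.
rewrite leq_addr leq_add2l -cS tS [k - 1 + t]addnC addnK.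
by rewrite !path_endE /= !(count_indicator_word _ _ cyc tS) subnn add0n.
Qed.

(** Here [h] is i - 1, the starting height. The prescribed end point amounts to |B| = r, and a path
    stays in the diagram exactly when its points after 0, ..., |S| steps do. *)
Lemma diagram_path_iff (S : finType) (s : {perm S}) (m r : nat)
    (f l : 'I_r -> S) (x : S) (B : {set S}) :
    cyclic_perm s -> #|S| = m + r ->
  let k := diag_k s f l x in
  (exists (i : nat) (w : seq step),
    [/\ 1 <= i <= k,
        path_end (diag_start k i) w = diag_end k m r i,
        all (diag_step s m f l x) (path_steps (diag_start k i) w)
      & north_labels s k x (diag_start k i) w = B]) <->
  #|B| = r /\
  exists2 h, h < k & forall t, t <= #|S| ->
    below s x (l @: [set: 'I_r]) t <= h + below s x B t
      <= k - 1 + below s x (f @: [set: 'I_r]) t.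
Proof.
move=> cyc cS k; have sB : size (indicator_word s x B) = #|S|.
  by rewrite size_mkseq.
have cB : count is_north (indicator_word s x B) = #|B|.
  by rewrite -(below_card x B cyc) -count_indicator_word // -sB take_size.
have S0 : 0 < #|S| by apply/card_gt0P; exists x.
split=> [[i [w [ik wend wsteps wB]]]|[rB [h hk hin]]].
  have sw : size w = #|S|.
    move: wend; rewrite path_endE /diag_end /= => -[].
    by rewrite cS; have := count_size is_north w; lia.
  have {wB}wE := (north_labels_word _ _ cyc ik sw).1 wB.
  rewrite {w sw}wE in wend wsteps.
  split.
    by move: wend; rewrite path_endE /diag_end cB => -[_]; lia.
  exists (i - 1) => [|t tS]; first by lia.
  rewrite -(@in_region_path_end _ s m r f l x B i t cyc cS ik tS).
  move: wsteps; rewrite path_stepsE all_map sB => /allP stepsP.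
  have {}stepsP u (uS : u \in iota 0 #|S|) := andP (stepsP u uS).
  (* Each point of the path starts a step, except the final one, which only ends the last step; that
     step exists because [S] contains [x]. *)
  case: (ltnP t #|S|) => [tltS|St].
    by case: (stepsP t); rewrite ?mem_iota.
  have lastS : #|S|.-1 < #|S| by rewrite prednK.
  have -> : t = #|S|.-1.+1 by rewrite prednK //; apply/eqP; rewrite eqn_leq tS.
  rewrite (take_nth East) ?sB // -cats1 /path_end foldl_cat /=.
  by case: (stepsP #|S|.-1); rewrite ?mem_iota.
exists h.+1, (indicator_word s x B).
have ik : 1 <= h.+1 <= k by [].
split=> //; last by apply/(north_labels_word _ _ cyc ik).
  by rewrite path_endE /diag_end cB sB rB cS addnK.
have inreg t : t <= #|S| -> in_region s m f l x
    (path_end (diag_start k h.+1) (take t (indicator_word s x B))).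
  by move=> tS; rewrite in_region_path_end // subn1 hin.
rewrite path_stepsE all_map sB; apply/allP=> t; rewrite mem_iota => /= tS.
apply/andP; split; first by apply: inreg; apply: ltnW.
have := inreg t.+1 tS; rewrite (take_nth East) ?sB //.
by rewrite -cats1 /path_end foldl_cat.
Qed.

(** * Interleaving of the end points *)

Lemma intervals_wrap (S : finType) (s : {perm S}) (r : nat)
    (f l : 'I_r -> S) (x : S) (j : 'I_r) : cyclic_perm s ->
  (x \in intervals s f l j) && (x != f j) =
  (cpos s x (l j) < cpos s x (f j)).
Proof.
move=> cyc; rewrite -(inj_eq (@cpos_inj _ s x cyc)) (mem_sinterval x _ _ _ cyc).
have -> : cpos s x x = 0.
  by apply: (@cpos_iter _ s x 0 cyc); apply/card_gt0P; exists x.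
lia.
Qed.

Lemma diag_kE (S : finType) (s : {perm S}) (r : nat)
    (f l : 'I_r -> S) (x : S) : cyclic_perm s ->
  diag_k s f l x = (\sum_j (cpos s x (l j) < cpos s x (f j))).+1.
Proof.
move=> cyc; rewrite -big_mkcond sum1dep_card; congr _.+1.
by apply: eq_card => j; rewrite inE intervals_wrap // inE.
Qed.

(** Of two intervals with a common first element, one contains the other. *)
Lemma first_inj (S : finType) (s : {perm S}) (r : nat) (f l : 'I_r -> S) :
  cyclic_perm s -> antichain (intervals s f l) -> injective f.
Proof.
move=> cyc anti i j fij; apply/eqP/negPn/negP=> neq_ij.
have := antichain_cpos (f i) cyc anti neq_ij.
rewrite eq_sym in neq_ij; have := antichain_cpos (f i) cyc anti neq_ij.
by rewrite /= fij; lia.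
Qed.

Lemma last_inj (S : finType) (s : {perm S}) (r : nat) (f l : 'I_r -> S) :
  cyclic_perm s -> antichain (intervals s f l) -> injective l.
Proof.
move=> cyc anti i j lij; apply/eqP/negPn/negP=> neq_ij.
have := antichain_cpos (l i) cyc anti neq_ij.
rewrite eq_sym in neq_ij; have := antichain_cpos (l i) cyc anti neq_ij.
by rewrite /= lij; lia.
Qed.

(** The identity holds for each i separately, by comparing interval i with interval j. It is the
    shift by k - 1 between the ranks of first and last elements, with a correction by r when
    interval j crosses the cut. *)
Lemma below_first_last (S : finType) (s : {perm S}) (r : nat)
    (f l : 'I_r -> S) (x : S) (j : 'I_r) :
    cyclic_perm s -> antichain (intervals s f l) ->
  let a := cpos s x (f j) in let b := cpos s x (l j) in
  below s x (f @: [set: 'I_r]) a + diag_k s f l x =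
  below s x (l @: [set: 'I_r]) b + (if b < a then r else 0) + 1.
Proof.
move=> cyc anti a b.
rewrite !below_imset; [|exact: last_inj anti|exact: first_inj anti].
rewrite diag_kE // addnS addn1; congr _.+1; rewrite -big_split /=.
have -> : (if b < a then r else 0) = \sum_(i < r) (b < a).
  by rewrite sum_nat_const card_ord; case: (b < a); rewrite ?muln1 ?muln0.
rewrite -big_split /=; apply: eq_bigr => i _; rewrite /a /b.
have [->|neq_ij] := eqVneq i j; first by rewrite !ltnn.
have := antichain_cpos x cyc anti neq_ij.
rewrite eq_sym in neq_ij; have := antichain_cpos x cyc anti neq_ij.
rewrite /=; lia.
Qed.

(* Each [j] contributes at most as much to the left as to the right. *)
Lemma matching_exchange (S : finType) (s : {perm S}) (r : nat)
    (f l g : 'I_r -> S) (x : S) (t u : nat) :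
    cyclic_perm s -> antichain (intervals s f l) -> injective g ->
    (forall j, g j \in intervals s f l j) ->
  below s x (l @: [set: 'I_r]) u + below s x (g @: [set: 'I_r]) t <=
  (diag_k s f l x - 1) + below s x (f @: [set: 'I_r]) t
    + below s x (g @: [set: 'I_r]) u.
Proof.
move=> cyc anti ginj gin.
rewrite !below_imset //; [|exact: first_inj anti|exact: last_inj anti].
rewrite diag_kE // subn1 /= -!big_split /=; apply: leq_sum => j _.
have := gin j; rewrite (mem_sinterval x _ _ _ cyc); lia.
Qed.

(** * Bases and starting heights *)

Lemma basis_shift (S : finType) (s : {perm S}) (r : nat)
    (f l : 'I_r -> S) (x : S) (B : {set S}) :
    cyclic_perm s -> antichain (intervals s f l) ->
    transversal_basis (intervals s f l) B ->
  #|B| = r /\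
  exists2 h, h < diag_k s f l x & forall t, t <= #|S| ->
    below s x (l @: [set: 'I_r]) t <= h + below s x B t
      <= diag_k s f l x - 1 + below s x (f @: [set: 'I_r]) t.
Proof.
move=> cyc anti basB.
have [g [ginj gin ->]] := transversal_basis_matching (first_inj cyc anti)
  (first_mem_intervals s f l) basB.
split; first by rewrite card_imset // cardsT card_ord.
set L := below s x (l @: _); set F := below s x (f @: _).
set G := below s x (g @: _).
have exch t u : L u + G t <= (diag_k s f l x - 1) + F t + G u.
  exact: matching_exchange.
have F0 : F 0 = 0 := below0 _ _ _.
have G0 : G 0 = 0 := below0 _ _ _.
(* Truncating negative differences at 0 does not affect the maximum, since the difference at u = 0
   is 0. *)
clearbody L F G; pose D (u : 'I_#|S|.+1) := L u - G u.
exists (\max_u D u).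
  have -> : diag_k s f l x = (diag_k s f l x - 1).+1 by rewrite subn1.
  rewrite ltnS; apply/bigmax_leqP => u _.
  by have := exch 0 u; rewrite /D; lia.
move=> t tS; apply/andP; split.
  have tS' : t < #|S|.+1 by [].
  have : D (Ordinal tS') <= \max_u D u by apply: leq_bigmax.
  by rewrite /D /= leq_subLR addnC.
(* The case u = 0 of [exch] makes the subtraction exact. *)
rewrite addnC -leq_subRL; last first.
  have := exch t 0; rewrite G0; lia.
apply/bigmax_leqP => u _; have := exch t u; have := exch t 0.
rewrite /D G0; lia.
Qed.

(** The values h + rank over [B] are r consecutive integers, hence distinct modulo r, which makes
    the matching injective. Staying above P places each element before the end of its interval, and
    staying below Q places it after the beginning, up to crossings of the cut. *)
Lemma shift_basis (S : finType) (s : {perm S}) (r : nat)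
    (f l : 'I_r -> S) (x : S) (B : {set S}) (h : nat) :
    cyclic_perm s -> antichain (intervals s f l) -> #|B| = r ->
    (forall t, t <= #|S| ->
      below s x (l @: [set: 'I_r]) t <= h + below s x B t
        <= diag_k s f l x - 1 + below s x (f @: [set: 'I_r]) t) ->
  transversal_basis (intervals s f l) B.
Proof.
move=> cyc anti cB hin.
have finj := first_inj cyc anti; have linj := last_inj cyc anti.
rewrite (transversal_basisE _ finj (first_mem_intervals s f l)) card_ord cB.
rewrite eqxx andbT.
set L := l @: _ in hin; set F := f @: _ in hin.
have lL j : l j \in L by rewrite imset_f.
have cL : #|L| = r by rewrite card_imset // cardsT card_ord.
have cF : #|F| = r by rewrite card_imset // cardsT card_ord.
have rkl_lt j : below s x L (cpos s x (l j)) < r by rewrite -cL below_rank_lt.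
(* Injectivity on ['I_r] makes every value below r the rank of a last element, so the [pick] in
   [phi] succeeds on [B]. *)
pose rkl j := Ordinal (rkl_lt j).
have rkl_inj : injective rkl.
  by move=> i j /(congr1 val) /= e; apply/linj/(@below_rank_inj _ s x L cyc).
have rklK v : v < r -> exists j, below s x L (cpos s x (l j)) = v.
  move=> vr; exists (invF rkl_inj (Ordinal vr)).
  by have /(congr1 val) := f_invF rkl_inj (Ordinal vr).
(* The height of the path just before its North step labelled [y]. *)
pose q y := h + below s x B (cpos s x y).
pose phi := [ffun y => [pick j | below s x L (cpos s x (l j)) == q y %% r]].
have phiP y : y \in B ->
    exists2 j, phi y = Some j & below s x L (cpos s x (l j)) = q y %% r.
  move=> yB; rewrite ffunE; case: pickP => [j /eqP e|none]; first by exists j.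
  have r0 : 0 < r by rewrite -cB; apply/card_gt0P; exists y.
  by have [j e] := rklK _ (ltn_pmod (q y) r0); have := none j; rewrite e eqxx.
apply/partial_transversalP; exists phi; apply/matchingP; split=> [y yB|y z yB zB].
  have [j ej rj] := phiP y yB; exists j => //.
  rewrite (mem_sinterval x _ _ _ cyc).
  have yS := cpos_lt x y cyc.
  have := below_first_last x j cyc anti; rewrite /= -/L -/F rj.
  (* The bound by P is taken before the step labelled [y] and the bound by Q after it; as that step
     is North, the latter is strict in [q y]. *)
  have /andP[lo _] := hin _ (ltnW yS); have /andP[_ hi] := hin _ yS.
  have yB1 : below s x B (cpos s x y) < below s x B (cpos s x y).+1.
    by apply: below_lt yB _; rewrite leqnn ltnSn.
  have {}lo : below s x L (cpos s x y) <= q y by [].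
  have {hi}hi : q y < diag_k s f l x - 1 + below s x F (cpos s x y).+1.
    by apply: leq_trans hi; rewrite /q -addnS leq_add2l.
  have ylast : below s x L (cpos s x y) <= below s x L (cpos s x (l j)) ->
      cpos s x y <= cpos s x (l j).
    move=> le; rewrite leqNgt; apply/negP=> lt.
    have := @below_lt _ s x L (l j) _ _ (lL j) (introT andP (conj (leqnn _) lt)).
    by rewrite ltnNge le.
  have yfirst : below s x F (cpos s x (f j)) < below s x F (cpos s x y).+1 ->
      cpos s x (f j) <= cpos s x y.
    move=> lt; rewrite leqNgt; apply/negP=> lt'.
    by have := below_le s x F lt'; rewrite leqNgt lt.
  have Fr : below s x F (cpos s x y).+1 <= r by rewrite -cF below_le_card.
  have k_le : diag_k s f l x - 1 <= r.
    by rewrite diag_kE // subn1 /= -[X in _ <= X]card_ord -sum1_card;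
      apply: leq_sum => i _; case: (_ < _).
  (* If [q y] is below r, then [y] comes no later than [l j]. This suffices when the interval
     crosses the cut; otherwise the rank identity puts [f j] no later than [y]. *)
  have [qr|rq] := ltnP (q y) r.
    rewrite modn_small // in rj *; rewrite rj in ylast.
    have {}ylast := ylast lo.
    case: ifP => [wrap _|nwrap rank]; first by rewrite ylast !orbT.
    have k0 : 0 < diag_k s f l x by [].
    by rewrite ylast yfirst //; lia.
  (* Now [l j] has rank [q y - r], which is below k - 1. The interval must cross the cut, as
     otherwise the rank of [f j] would be negative. *)
  have qr2 : q y < r + r by lia.
  have modq : q y %% r = q y - r.
    by rewrite -{1}(subnK rq) modnDr modn_small // ltn_subLR.
  rewrite modq in rj *; case: ifP => [wrap|nwrap] rank.
    have k0 : 0 < diag_k s f l x by [].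
    by rewrite yfirst ?orbT ?andbT //; lia.
  by exfalso; have := rkl_lt j; lia.
(* After cancelling [h], the ranks of [y] and [z] in [B] are congruent modulo r and both below r,
   hence equal. *)
have [i -> ei] := phiP y yB; have [j -> ej] := phiP z zB => -[eij].
rewrite eij ej in ei; apply: (@below_rank_inj _ s x B cyc) => //.
have := below_rank_lt x cyc yB; have := below_rank_lt x cyc zB; rewrite cB => ltz lty.
by move/eqP: ei; rewrite eqn_modDl !modn_small // => /eqP ->.
Qed.

Theorem theorem3p6 (S : finType) (s : {perm S}) (m r : nat)
    (f l : 'I_r -> S) (x : S) (B : {set S}) :
  cyclic_perm s ->
  antichain (intervals s f l) ->
  #|S| = m + r ->
  let k := diag_k s f l x in
  transversal_basis (intervals s f l) B <->
  exists (i : nat) (w : seq step),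
    [/\ 1 <= i <= k,
        path_end (diag_start k i) w = diag_end k m r i,
        all (diag_step s m f l x) (path_steps (diag_start k i) w)
      & north_labels s k x (diag_start k i) w = B].
Proof.
move=> cyc anti cS k; rewrite diagram_path_iff //; split.
  exact: basis_shift.
by case=> cB [h _ hin]; apply: shift_basis hin.
Qed.
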